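(* Let $K$ be a finite Kripke structure over $AP$ with state set $S$, let $\mathsf{spec}$ be a finite set of regular expressions over $AP$, let $\rho$ be a trace of $K$ and $h\ge 0$. Then there exists a trace $\rho'$ of $K$ induced by $\rho$, with $|\rho'|\le (|S|\cdot 2^{(2|\mathsf{spec}|)^2})^{h+2}$, which is $h$-prefix bisimilar to $\rho$ (w.r.t. $\mathsf{spec}$). In particular, for every $\mathsf{A}\overline{\mathsf{A}}\mathsf{B}\overline{\mathsf{B}}\overline{\mathsf{E}}$ formula $\psi$ whose atomic formulas are in $\mathsf{spec}$ and with $\mathrm{depth}_B(\psi)\le h$, $K,\rho\models\psi$ iff $K,\rho'\models\psi$.
   Context: A Kripke structure over a finite set $AP$ of proposition letters is $K=(AP,S,R,\mu,s_0)$ with $R\subseteq S\times S$, $\mu:S\to 2^{AP}$, $s_0\in S$. A trace is a nonempty finite word $\rho$ over $S$ with $(\rho(i),\rho(i+1))\in R$ for all $i<|\rho|$; $\rho(i,j)=\rho(i)\cdots\rho(j)$, $\mathrm{fst}(\rho)=\rho(1)$, $\mathrm{lst}(\rho)=\rho(|\rho|)$, $\mu(\rho)=\mu(\rho(1))\cdots\mu(\rho(|\rho|))$, $\mathrm{Pref}(\rho)=\{\rho(1,i):1\le i<|\rho|\}$ (proper prefixes), $\mathrm{Suff}(\rho)=\{\rho(i,|\rho|):2\le i\le|\rho|\}$ (proper suffixes); if $\mathrm{lst}(\rho)=\mathrm{fst}(\rho')$ then $\rho\star\rho'=\rho(1,|\rho|-1)\cdot\rho'$. Regular expressions (RE) over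 $AP$: $r::=\varepsilon\mid\phi\mid r\cup r\mid r\cdot r\mid r^*$ with $\phi$ propositional over $AP$, denoting languages over $2^{AP}$ ($\mathcal L(\phi)$ = sets $A\subseteq AP$ satisfying $\phi$, other clauses standard); $|r|$ is the number of subexpressions of $r$, and $|\mathsf{spec}|=\sum_{r\in\mathsf{spec}}|r|$. Write $\mathsf{spec}=\{r_1,\dots,r_H\}$ and for each $\ell$ let $\mathcal A_\ell=(2^{AP},Q_\ell,Q^0_\ell,\Delta_\ell,F_\ell)$ be the canonical complete NFA accepting $\mathcal L(r_\ell)$ obtained by the standard compositional construction, with $|Q_\ell|\le 2|r_\ell|$, the $Q_\ell$ pairwise disjoint. The summary of a trace $\rho$ is $\mathcal S(\rho)=(\rho(1),\Pi,\rho(|\rho|))$ where $\Pi$ is the set of pairs $(q,q')$ such that for some $\ell$, $q,q'\in Q_\ell$ and some run of $\mathcal A_\ell$ over $\mu(\rho)$ goes from $q$ to $q'$. Traces $\rho,\rho'$ are $0$-prefix bisimilar iff $\mathcal S(\rho)=\mathcal S(\rho')$; for $h>0$ they are $h$-prefix bisimilar iff $\mathcal S(\rho)=\mathcal S(\rho')$ and every proper prefix of either has a proper prefix of the other that is $(h-1)$-prefix bisimilar to it. A trace induced by $\rho$ (with $|\rho|=n$) is a trace of $K$ of the form $\rho(i_1)\cdots\rho(i_k)$ for positions $1=i_1<\dots<i_k=n$. $\mathsf{A}\overline{\mathsf{A}}\mathsf{B}\overline{\mathsf{B}}\overline{\mathsf{E}}$ formulas: $\psi::=r\mid\neg\psi\mid\psi\wedge\psi\mid\langle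 X\rangle\psi$, $X\in\{A,\overline A,B,\overline B,\overline E\}$, with semantics: $K,\rho\models r$ iff $\mu(\rho)\in\mathcal L(r)$; $\langle B\rangle\psi$ holds iff $\psi$ holds on some $\rho'\in\mathrm{Pref}(\rho)$; $\langle\overline B\rangle\psi$ (resp. $\langle\overline E\rangle\psi$) iff $\psi$ holds on some trace $\rho'$ with $\rho\in\mathrm{Pref}(\rho')$ (resp. $\rho\in\mathrm{Suff}(\rho')$); $\langle A\rangle\psi$ (resp. $\langle\overline A\rangle\psi$) iff $\psi$ holds on some trace $\rho'$ with $\mathrm{fst}(\rho')=\mathrm{lst}(\rho)$ (resp. $\mathrm{lst}(\rho')=\mathrm{fst}(\rho)$). $\mathrm{depth}_B$: $\mathrm{depth}_B(r)=0$, $\mathrm{depth}_B(\neg\psi)=\mathrm{depth}_B(\psi)$, $\mathrm{depth}_B(\psi\wedge\phi)=\max$, $\mathrm{depth}_B(\langle B\rangle\psi)=1+\mathrm{depth}_B(\psi)$, $\mathrm{depth}_B(\langle X\rangle\psi)=\mathrm{depth}_B(\psi)$ for $X\in\{A,\overline A,\overline B,\overline E\}$.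
   Formalization: The case of empty spec with |S|=1 is excluded, since there the bound is 1 and the claim fails for ρ=ss; the canonical complete automaton of a bare propositional formula has 3 states, because a complete one with at most 2 cannot exist when the formula is satisfiable. *)

(* Defs.v *)
From HB Require Import structures.
From mathcomp Require Import all_boot.
From mathcomp Require Import finmap.

Set Implicit Arguments.
Unset Strict Implicit.
Unset Printing Implicit Defensive.

Section Regex.
Variable AP : finType.

Inductive prop_form :=
| PTrue
| PVar of AP
| PNot of prop_form
| PAnd of prop_form & prop_form
| POr of prop_form & prop_form.

Fixpoint prop_sat (a : {set AP}) (phi : prop_form) : bool :=
  match phi with
  | PTrue => true
  | PVar p => p \in a
  | PNot f => ~~ prop_sat a f
  | PAnd f g => prop_sat a f && prop_sat a g
  | POr f g => prop_sat a f || prop_sat a g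
  end.

Inductive regex :=
| REps
| RAtom of prop_form
| RPlus of regex & regex
| RCat of regex & regex
| RStar of regex.

Definition word := seq {set AP}.

Fixpoint lang (r : regex) (w : word) : Prop :=
  match r with
  | REps => w = [::]
  | RAtom phi => exists2 a, w = [:: a] & prop_sat a phi
  | RPlus r1 r2 => lang r1 w \/ lang r2 w
  | RCat r1 r2 => exists u v, [/\ w = u ++ v, lang r1 u & lang r2 v]
  | RStar r1 =>
      exists2 us : seq word, w = flatten us & forall u, u \in us -> lang r1 u
  end.

(* Subexpressions are counted with multiplicity, and a propositional formula
   is a single (atomic) subexpression. *)
Fixpoint rsize (r : regex) : nat :=
  match r with
  | REps | RAtom _ => 1
  | RPlus r1 r2 | RCat r1 r2 => (rsize r1 + rsize r2).+1
  | RStar r1 => (rsize r1).+1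
  end.

Fixpoint prop_encode (phi : prop_form) : GenTree.tree AP :=
  match phi with
  | PTrue => GenTree.Node 0 [::]
  | PVar p => GenTree.Leaf p
  | PNot f => GenTree.Node 1 [:: prop_encode f]
  | PAnd f g => GenTree.Node 2 [:: prop_encode f; prop_encode g]
  | POr f g => GenTree.Node 3 [:: prop_encode f; prop_encode g]
  end.

Fixpoint prop_decode (t : GenTree.tree AP) : option prop_form :=
  match t with
  | GenTree.Leaf p => Some (PVar p)
  | GenTree.Node 0 [::] => Some PTrue
  | GenTree.Node 1 [:: t1] => omap PNot (prop_decode t1)
  | GenTree.Node n [:: t1; t2] =>
      match prop_decode t1, prop_decode t2 with
      | Some f, Some g => Some (if n == 2 then PAnd f g else POr f g)
      | _, _ => None
      end
  | _ => None
  end.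

Lemma prop_encodeK : pcancel prop_encode prop_decode.
Proof. by elim=> //= [f -> | f -> g -> | f -> g ->]. Qed.

HB.instance Definition _ := Countable.copy prop_form (pcan_type prop_encodeK).

Fixpoint regex_encode (r : regex) : GenTree.tree prop_form :=
  match r with
  | REps => GenTree.Node 0 [::]
  | RAtom phi => GenTree.Leaf phi
  | RStar r1 => GenTree.Node 1 [:: regex_encode r1]
  | RPlus r1 r2 => GenTree.Node 2 [:: regex_encode r1; regex_encode r2]
  | RCat r1 r2 => GenTree.Node 3 [:: regex_encode r1; regex_encode r2]
  end.

Fixpoint regex_decode (t : GenTree.tree prop_form) : option regex :=
  match t with
  | GenTree.Leaf phi => Some (RAtom phi)
  | GenTree.Node 0 [::] => Some REps
  | GenTree.Node 1 [:: t1] => omap RStar (regex_decode t1)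
  | GenTree.Node n [:: t1; t2] =>
      match regex_decode t1, regex_decode t2 with
      | Some r1, Some r2 => Some (if n == 2 then RPlus r1 r2 else RCat r1 r2)
      | _, _ => None
      end
  | _ => None
  end.

Lemma regex_encodeK : pcancel regex_encode regex_decode.
Proof. by elim=> //= [r1 -> r2 -> | r1 -> r2 -> | r1 ->]. Qed.

HB.instance Definition _ := Countable.copy regex (pcan_type regex_encodeK).

Record nfa := Nfa {
  nfa_state :> finType;
  nfa_init : {set nfa_state};
  nfa_trans : nfa_state -> {set AP} -> nfa_state -> bool;
  nfa_final : {set nfa_state}
}.

Definition nfa_is_complete (A : nfa) : Prop :=
  forall (q : A) (a : {set AP}), exists p : A, nfa_trans q a p.

Fixpoint nfa_run (A : nfa) (q : A) (w : word) (q' : A) : bool :=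
  match w with
  | [::] => q == q'
  | a :: w' => [exists p : A, nfa_trans q a p && nfa_run p w' q']
  end.

Definition nfa_accepts (A : nfa) (w : word) : Prop :=
  exists q q' : A, [/\ q \in nfa_init A, q' \in nfa_final A & nfa_run q w q'].

Definition nfa_eps : nfa :=
  @Nfa unit [set: unit] (fun _ _ _ => false) [set: unit].

Definition nfa_atom (phi : prop_form) : nfa :=
  @Nfa bool [set false] (fun q a p => [&& ~~ q, p & prop_sat a phi]) [set true].

Definition nfa_plus (A B : nfa) : nfa :=
  @Nfa (A + B)%type
    [set q | match q with inl p => p \in nfa_init A | inr p => p \in nfa_init B end]
    (fun q a p => match q, p with
                  | inl q, inl p => nfa_trans q a p
                  | inr q, inr p => nfa_trans q a p
                  | _, _ => false
                  end)
    [set q | match q with inl p => p \in nfa_final A | inr p => p \in nfa_final B end].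

(* Without epsilon-transitions: a transition of [A] into a final state may
   enter [B] at an initial state instead. *)
Definition nfa_cat (A B : nfa) : nfa :=
  @Nfa (A + B)%type
    [set q | match q with
             | inl p => p \in nfa_init A
             | inr p => [exists f : A, (f \in nfa_init A) && (f \in nfa_final A)]
                        && (p \in nfa_init B)
             end]
    (fun q a p => match q, p with
                  | inl q, inl p => nfa_trans q a p
                  | inl q, inr p => (p \in nfa_init B) &&
                      [exists f : A, (f \in nfa_final A) && nfa_trans q a f]
                  | inr q, inr p => nfa_trans q a p
                  | inr _, inl _ => false
                  end)
    [set q | if q is inr p then p \in nfa_final B else false].

(* [None] is an isolated state accepting the empty word. *)
Definition nfa_star (A : nfa) : nfa :=
  @Nfa (option A)
    [set q | if q is Some p then p \in nfa_init A else true]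
    (fun q a p => match q, p with
                  | Some q, Some p => nfa_trans q a p || (p \in nfa_init A) &&
                      [exists f : A, (f \in nfa_final A) && nfa_trans q a f]
                  | _, _ => false
                  end)
    [set q | if q is Some p then p \in nfa_final A else true].

Fixpoint nfa_of_regex (r : regex) : nfa :=
  match r with
  | REps => nfa_eps
  | RAtom phi => nfa_atom phi
  | RPlus r1 r2 => nfa_plus (nfa_of_regex r1) (nfa_of_regex r2)
  | RCat r1 r2 => nfa_cat (nfa_of_regex r1) (nfa_of_regex r2)
  | RStar r1 => nfa_star (nfa_of_regex r1)
  end.

(* [None] is the sink state. *)
Definition nfa_completion (A : nfa) : nfa :=
  @Nfa (option A)
    [set q | if q is Some p then p \in nfa_init A else false]
    (fun q a p => match q, p with
                  | Some q, Some p => nfa_trans q a p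
                  | Some q, None => ~~ [exists p : A, nfa_trans q a p]
                  | None, p => p == None
                  end)
    [set q | if q is Some p then p \in nfa_final A else false].

Definition canonical_nfa (r : regex) : nfa := nfa_completion (nfa_of_regex r).

Lemma canonical_nfa_complete r : nfa_is_complete (canonical_nfa r).
Proof.
move=> [q|] a /=; last by exists None.
have [/existsP [p qp]|nq] := boolP [exists p, nfa_trans q a p].
  by exists (Some p).
by exists None.
Qed.

(* The automaton of a single propositional formula has 2 states and a sink: no
   complete NFA with at most 2 states accepts exactly the one-letter words whose
   letter satisfies a given satisfiable formula. *)
Lemma card_canonical_nfa r :
  (forall phi, r <> RAtom phi) -> #|canonical_nfa r| <= 2 * rsize r.
Proof.
pose small r' := if r' is RAtom _ then #|nfa_of_regex r'| == 2
                 else #|nfa_of_regex r'| < 2 * rsize r'.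
have smallW r' : small r' -> #|nfa_of_regex r'| <= 2 * rsize r'.
  by case: r' => [/ltnW|phi /= /eqP ->|r1 r2 /ltnW|r1 r2 /ltnW|r1 /ltnW].
suff H : small r.
  by move: H; case: r => [|phi|r1 r2|r1 r2|r1] H ne;
     rewrite card_option //; case: (ne phi).
elim: r => [|phi|r1 H1 r2 H2|r1 H1 r2 H2|r1 H1]; rewrite /small /=.
- by rewrite card_unit.
- by rewrite card_bool.
- by rewrite card_sum mulnS mulnDr add2n ltnS leqW // leq_add // smallW.
- by rewrite card_sum mulnS mulnDr add2n ltnS leqW // leq_add // smallW.
- by rewrite card_option mulnS add2n !ltnS smallW.
Qed.

Lemma run_completion (A : nfa) (q p : A) w :
  @nfa_run (nfa_completion A) (Some q) w (Some p) = nfa_run q w p.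
Proof.
elim: w q => [|a w IH] q //=; apply/existsP/existsP.
- case=> [[x|]] /andP [H1 H2]; first by exists x; rewrite H1 -IH.
  by exfalso; elim: w {IH} H2 => [|b w IHw] //= /existsP [[y|]].
- by case=> x /andP [H1 H2]; exists (Some x); rewrite /= H1 IH.
Qed.

Lemma accepts_completion A w : nfa_accepts (nfa_completion A) w <-> nfa_accepts A w.
Proof.
split.
- by case=> [[q|]] [[p|]] []; rewrite ?inE // => H1 H2; rewrite run_completion; exists q, p.
- by case=> q [p [H1 H2 H3]]; exists (Some q), (Some p); rewrite !inE run_completion.
Qed.

Lemma run_plus_l (A B : nfa) (q : A) w (p : nfa_plus A B) :
  @nfa_run (nfa_plus A B) (inl q) w p = if p is inl p then nfa_run q w p else false.
Proof.
elim: w q => [|a w IH] q /=; first by case: p.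
case: p IH => p IH.
- apply/existsP/existsP => [[[x|x]] /andP [] //|[x]] H1.
    by rewrite IH => H2; exists x; rewrite H1.
  by exists (inl x); rewrite IH.
- by apply/existsP => [[[x|x]]] /andP [] // _; rewrite IH.
Qed.

Lemma run_plus_r (A B : nfa) (q : B) w (p : nfa_plus A B) :
  @nfa_run (nfa_plus A B) (inr q) w p = if p is inr p then nfa_run q w p else false.
Proof.
elim: w q => [|a w IH] q /=; first by case: p.
case: p IH => p IH.
- by apply/existsP => [[[x|x]]] /andP [] // _; rewrite IH.
- apply/existsP/existsP => [[[x|x]] /andP [] //|[x]] H1.
    by rewrite IH => H2; exists x; rewrite H1.
  by exists (inr x); rewrite IH.
Qed.

Lemma accepts_plus A B w :
  nfa_accepts (nfa_plus A B) w <-> nfa_accepts A w \/ nfa_accepts B w.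
Proof.
split.
- case=> [[q|q]] [p [Hq Hp]]; rewrite ?run_plus_l ?run_plus_r;
    case: p Hp => // p Hp; rewrite !inE in Hq Hp.
  + by left; exists q, p.
  + by right; exists q, p.
- case=> -[q [p [Hq Hp H]]].
  + by exists (inl q), (inl p); rewrite !inE run_plus_l.
  + by exists (inr q), (inr p); rewrite !inE run_plus_r.
Qed.

Lemma run_cat_rr (A B : nfa) (q : B) w (p : B) :
  @nfa_run (nfa_cat A B) (inr q) w (inr p) = nfa_run q w p.
Proof.
elim: w q => [|a w IH] q //=.
apply/existsP/existsP => [[[x|x]] /andP [] //|[x]] H1.
  by rewrite IH => H2; exists x; rewrite H1.
by exists (inr x); rewrite IH.
Qed.

Lemma run_cat_lr (A B : nfa) (q : A) w (p : B) :
  @nfa_run (nfa_cat A B) (inl q) w (inr p) <->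
  exists u v f i, [/\ w = u ++ v, u != [::], f \in nfa_final A, nfa_run q u f
     & i \in nfa_init B /\ nfa_run i v p].
Proof.
split.
- elim: w q => [|a w IH] q //= /existsP [[x|x]] /andP [].
  + move=> Hx /IH [u [v [f [i [-> Hu Hf Hr Hi]]]]].
    exists (a :: u), v, f, i; split=> //.
    by apply/existsP; exists x; rewrite Hx.
  + case/andP=> Hx /existsP [f /andP [Hf Hqf]]; rewrite run_cat_rr => Hr.
    exists [:: a], w, f, x; split=> //.
    by apply/existsP; exists f; rewrite Hqf /=.
- case=> u [v [f [i [-> Hu Hf Hr [Hi Hv]]]]].
  elim: u q Hu Hr => [|a u IH] q //= _ /existsP [x /andP [Hx Hr]].
  apply/existsP; case: u IH Hr => [|b u] IH Hr.
  + exists (inr i); rewrite /= run_cat_rr Hv Hi andbT.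
    by apply/existsP; exists x; rewrite Hx (eqP Hr) Hf.
  + by exists (inl x); rewrite Hx; apply: IH.
Qed.

Lemma accepts_cat A B w :
  nfa_accepts (nfa_cat A B) w <->
  exists u v, [/\ w = u ++ v, nfa_accepts A u & nfa_accepts B v].
Proof.
split.
- case=> [[q|q]] [[p|p] []]; rewrite !inE // => Hq Hp.
  + case/run_cat_lr=> u [v [f [i [-> _ Hf Hr [Hi Hv]]]]].
    by exists u, v; split=> //; [exists q, f|exists i, p].
  + case/andP: Hq => /existsP [f /andP [H1 H2]] Hq; rewrite run_cat_rr => H.
    by exists [::], w; split=> //; [exists f, f; split=> /=|exists q, p].
- case=> u [v [-> [q [f [Hq Hf Hu]]] [i [p [Hi Hp Hv]]]]].
  case: u Hu => [|a u] Hu.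
  + exists (inr i), (inr p); rewrite !inE run_cat_rr; split=> //.
    by rewrite Hi andbT; apply/existsP; exists q; rewrite Hq (eqP Hu).
  + exists (inl q), (inr p); rewrite !inE; split=> //.
    by apply/run_cat_lr; exists (a :: u), v, f, i.
Qed.

Lemma run_star_dec (A : nfa) (q p : A) w :
  p \in nfa_final A ->
  @nfa_run (nfa_star A) (Some q) w (Some p) ->
  exists u us f, [/\ w = u ++ flatten us, f \in nfa_final A, nfa_run q u f
     & forall v, v \in us -> nfa_accepts A v].
Proof.
move=> Hp; elim: w q => [|a w IH] q /=.
  by move/eqP=> [->]; exists [::], [::], p; split=> //=.
case/existsP=> [[x|]] //= /andP [/orP [Hx|/andP [Hx /existsP [f /andP [Hf Hqf]]]]] /IH
  [u [us [f' [-> Hf' Hr Hus]]]].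
- exists (a :: u), us, f'; split=> //=.
  by apply/existsP; exists x; rewrite Hx.
- exists [:: a], (u :: us), f; split=> //=.
    by apply/existsP; exists f; rewrite Hqf /=.
  by move=> v; rewrite inE => /orP [/eqP ->|/Hus //]; exists x, f'.
Qed.

Lemma run_star_sub (A : nfa) (q p : A) w :
  nfa_run q w p -> @nfa_run (nfa_star A) (Some q) w (Some p).
Proof.
elim: w q => [|a w IH] q /=; first by move/eqP=> ->.
by case/existsP=> x /andP [Hx /IH H]; apply/existsP; exists (Some x); rewrite Hx.
Qed.

Lemma run_star_jump (A : nfa) (q f i : A) u v p :
  u != [::] -> nfa_run q u f -> f \in nfa_final A -> i \in nfa_init A ->
  @nfa_run (nfa_star A) (Some i) v p -> @nfa_run (nfa_star A) (Some q) (u ++ v) p.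
Proof.
move=> Hu Hr Hf Hi Hv; elim: u q Hu Hr => [|a u IH] q //= _ /existsP [x /andP [Hx Hr]].
apply/existsP; case: u IH Hr => [|b u] IH Hr.
- exists (Some i); rewrite Hi Hv andbT; apply/orP; right.
  by apply/existsP; exists x; rewrite Hx (eqP Hr) Hf.
- by exists (Some x); rewrite Hx; apply: IH.
Qed.

Lemma accepts_star A w :
  nfa_accepts (nfa_star A) w <->
  exists2 us : seq word, w = flatten us & forall u, u \in us -> nfa_accepts A u.
Proof.
split.
- case=> [[q|]] [p [Hq Hp]].
  + case: p Hp => [p|] Hp; rewrite !inE in Hq Hp.
    * case/(run_star_dec Hp)=> u [us [f [-> Hf Hr Hus]]].
      exists (u :: us) => // v; rewrite inE => /orP [/eqP ->|/Hus //].
      by exists q, f.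
    * move=> H; suff: false by [].
      by elim: w q {Hq} H => [|a w IH] q //= /existsP [[x|]] // /andP [_ /IH].
  + case: w => [|a w] /=; first by exists [::].
    by case/existsP.
- case=> us ->; elim: us => [|u us IH] H.
    by exists None, None; rewrite !inE /=.
  have [q [f [Hq Hf Hr]]] := H u (mem_head _ _).
  have {}IH := IH (fun v Hv => H v (mem_behead (s := u :: us) Hv)).
  case: u H Hr => [|a u] H Hr; first exact: IH.
  case: IH => [[i|]] [p [Hi Hp Hv]].
  + rewrite !inE in Hi; exists (Some q), p; rewrite inE; split=> //.
    exact: (run_star_jump (u := a :: u) _ Hr Hf Hi Hv).
  + have E : flatten us = [::].
      by case: (flatten us) Hv => //= b v /existsP [].
    exists (Some q), (Some f); rewrite !inE; split=> //.
    by rewrite /= E cats0; apply: (run_star_sub (w := a :: u)).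
Qed.

Lemma canonical_nfaP r w : nfa_accepts (canonical_nfa r) w <-> lang r w.
Proof.
rewrite accepts_completion; elim: r w => [|phi|r1 H1 r2 H2|r1 H1 r2 H2|r H] w /=.
- split=> [[q [p [_ _]]]|->]; last by exists tt, tt; rewrite !inE.
  by case: w => //= a w /existsP [].
- split=> [[q [p []]]|[a -> Ha]].
    rewrite !inE => /eqP -> /eqP ->; case: w => //= a w /existsP [[|]] //=.
    case/andP=> Ha; case: w => [|b w]; first by exists a.
    by case/existsP.
  exists false, true; rewrite !inE; split=> //=.
  by apply/existsP; exists true; rewrite /= Ha.
- by rewrite accepts_plus H1 H2.
- rewrite accepts_cat; split=> -[u [v [-> Hu Hv]]]; exists u, v;
    by split=> //; [apply/H1|apply/H2].
- by rewrite accepts_star; split=> -[us -> Hus]; exists us => // u /Hus /H.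
Qed.

Local Open Scope fset_scope.

Definition spec_size (spec : {fset regex}) : nat := \sum_(r <- spec) rsize r.

Record kripke := Kripke {
  kstate :> finType;
  kedge : rel kstate;
  klabel : kstate -> {set AP};
  kinit : kstate
}.

Section Traces.
Variable K : kripke.
Implicit Types rho : seq K.

Definition is_trace rho : bool := (rho != [::]) && sorted (@kedge K) rho.

(* The default value [kinit K] is irrelevant on nonempty words. *)
Definition tfst rho : K := head (kinit K) rho.
Definition tlst rho : K := last (kinit K) rho.

Definition tlabel rho : word := map (@klabel K) rho.

Definition Pref rho : seq (seq K) := [seq take i rho | i <- iota 1 (size rho).-1].
Definition Suff rho : seq (seq K) := [seq drop i rho | i <- iota 1 (size rho).-1].

(* Positions are numbered from 0; the chosen ones are [0 :: js]. *)
Definition induced rho rho' : Prop :=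
  is_trace rho' /\
  exists js : seq nat,
    [/\ path ltn 0 js, last 0 js = (size rho).-1
      & rho' = [seq nth (kinit K) rho i | i <- 0 :: js]].

Section Summaries.
Variable spec : {fset regex}.

(* The disjoint union, over the expressions [r] of [spec], of the squares of
   the state sets of their automata. *)
Definition state_pair : finType :=
  {r : spec & (canonical_nfa (val r) * canonical_nfa (val r))%type}.

Definition summary rho : K * {set state_pair} * K :=
  (tfst rho,
   [set x : state_pair | nfa_run (tagged x).1 (tlabel rho) (tagged x).2],
   tlst rho).

Fixpoint prefix_bisim (h : nat) rho rho' : Prop :=
  summary rho = summary rho' /\
  if h is h'.+1 then
    (forall nu, nu \in Pref rho ->
       exists2 nu', nu' \in Pref rho' & prefix_bisim h' nu nu') /\
    (forall nu', nu' \in Pref rho' ->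
       exists2 nu, nu \in Pref rho & prefix_bisim h' nu nu')
  else True.

End Summaries.
End Traces.

Inductive modality := ModA | ModAbar | ModB | ModBbar | ModEbar.

Inductive form :=
| FAtom of regex
| FNot of form
| FAnd of form & form
| FDia of modality & form.

Fixpoint atoms (psi : form) : {fset regex} :=
  match psi with
  | FAtom r => [fset r]
  | FNot f => atoms f
  | FAnd f g => atoms f `|` atoms g
  | FDia _ f => atoms f
  end.

Fixpoint depthB (psi : form) : nat :=
  match psi with
  | FAtom _ => 0
  | FNot f => depthB f
  | FAnd f g => maxn (depthB f) (depthB g)
  | FDia ModB f => (depthB f).+1
  | FDia _ f => depthB f
  end.

Definition mod_rel (K : kripke) (X : modality) (rho rho' : seq K) : bool :=
  match X with
  | ModA => tfst rho' == tlst rho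
  | ModAbar => tlst rho' == tfst rho
  | ModB => rho' \in Pref rho
  | ModBbar => rho \in Pref rho'
  | ModEbar => rho \in Suff rho'
  end.

Fixpoint sat (K : kripke) (psi : form) (rho : seq K) : Prop :=
  match psi with
  | FAtom r => lang r (tlabel rho)
  | FNot f => ~ sat f rho
  | FAnd f g => sat f rho /\ sat g rho
  | FDia X f =>
      exists rho' : seq K, [/\ is_trace rho', mod_rel X rho rho' & sat f rho']
  end.

End Regex.

(* Main.v *)
(* The class of a prefix for (h+1)-prefix bisimilarity is its summary together
   with the set of h-classes of its proper prefixes, and h-prefix bisimilarity
   is a congruence for concatenation.  Hence, when two prefixes of a trace, both
   different from the whole trace, are h-bisimilar, the factor between their ends
   can be cut out.  A trace that can no longer be shortened has length at most
   T_h + 1, where T_h is the number of h-classes of its prefixes.  Let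
   N = |S| * 2 ^ ((2 |spec|) ^ 2), which bounds the number of summaries of
   prefixes.  Along a trace the sets of h-classes of proper prefixes form an
   increasing chain, whose members are nonempty after the first position; thus
   T_0 <= N and T_(h+1) <= 1 + N * T_h, so T_h + 1 <= N^(h+1) + N^h <= N^(h+2)
   because N >= 2. *)
Require Import Defs.
From mathcomp Require Import all_boot.
From mathcomp Require Import finmap.

Set Implicit Arguments.
Unset Strict Implicit.
Unset Printing Implicit Defensive.

(** * Runs of automata and of their completions *)

Section NfaRuns.
Variable AP : finType.

Lemma nfa_run_cat (A : nfa AP) (q p : A) u v :
  nfa_run q (u ++ v) p = [exists m : A, nfa_run q u m && nfa_run m v p].
Proof.
elim: u q => [|a u IH] q /=.
  apply/idP/existsP => [H|[m /andP [/eqP -> //]]].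
  by exists q; rewrite eqxx.
apply/existsP/existsP => [[x /andP [Hx]]|[m /andP [/existsP [x /andP [Hx Hu]] Hv]]].
  rewrite IH => /existsP [m /andP [Hu Hv]]; exists m; rewrite Hv andbT.
  by apply/existsP; exists x; rewrite Hx.
by exists x; rewrite Hx IH; apply/existsP; exists m; rewrite Hu.
Qed.

(** The pairs from which all runs over a nonempty word can be recovered. For an atom, the only one
    kept leads from the initial to the final state. *)
Definition relevant_pair (r : regex AP) :
    pred (canonical_nfa r * canonical_nfa r)%type :=
  match r with
  | RAtom phi => pred1 (Some false, Some true)
  | _ => predT
  end.

Lemma completion_run_sink (A : nfa AP) w (p : nfa_completion A) :
  @nfa_run _ (nfa_completion A) None w p = (p == None).
Proof.
elim: w => [|a w IH] /=; first by rewrite eq_sym.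
apply/existsP/idP => [[[x|] /andP [//]]|Hp]; first by rewrite IH.
by exists None; rewrite IH.
Qed.

(** Under determinism the completion has a single run from [q], which falls into the sink exactly
    when [A] gets stuck. With nondeterminism one run may get stuck while another survives. *)
Lemma completion_run_to_sink (A : nfa AP) (q : A) w :
  (forall (x y z : A) a, nfa_trans x a y -> nfa_trans x a z -> y = z) ->
  @nfa_run _ (nfa_completion A) (Some q) w None = ~~ [exists p : A, nfa_run q w p].
Proof.
move=> det; elim: w q => [|a w IH] q /=.
  by apply/esym/negbTE/negPn/existsP; exists q.
have [/existsP [x qx]|none] := boolP [exists x : A, nfa_trans q a x].
  have -> : [exists p : A, exists y : A, nfa_trans q a y && nfa_run y w p] =
            [exists p : A, nfa_run x w p].
    apply/existsP/existsP => [[p /existsP [y /andP [/(det _ _ _ _ qx) <-]]]|[p Hp]].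
      by exists p.
    by exists p; apply/existsP; exists x; rewrite qx.
  rewrite -IH; apply/existsP/idP => [[[y|] /andP []]|H].
  - by move/(det _ _ _ _ qx) => <-.
  - by [].
  - by exists (Some x); rewrite qx.
have -> : ~~ [exists p : A, exists y : A, nfa_trans q a y && nfa_run y w p].
  apply: contra none => /existsP [p /existsP [y /andP [qy _]]].
  by apply/existsP; exists y.
by apply/existsP; exists None; rewrite completion_run_sink.
Qed.

Lemma nfa_atom_run phi (q p : nfa_atom phi) (a : {set AP}) w :
  nfa_run q (a :: w) p -> (q, p) = (false, true).
Proof.
elim: w q a => [|b w IH] q a /existsP [x /andP [/and3P [/negbTE -> Hx _]]].
  by move/eqP => <-; case: (x) Hx.
by move/IH => [Ex _]; rewrite Ex in Hx.
Qed.

(* The completed automaton of an atom has 9 pairs of states, more than the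
   [(2 * 1) ^ 2] allowed by the bound; but it is deterministic, and on nonempty
   words its transition relation is determined by a single pair. *)
Lemma relevant_run (r : regex AP) w w' :
  w != [::] -> w' != [::] ->
  (forall x, @relevant_pair r x -> nfa_run x.1 w x.2 = nfa_run x.1 w' x.2) ->
  forall x : canonical_nfa r * canonical_nfa r,
    nfa_run x.1 w x.2 = nfa_run x.1 w' x.2.
Proof.
case: r => [|phi|r1 r2|r1 r2|r1]; try by move=> _ _ H x; apply: H.
case: w w' => [//|a w] [//|a' w'] _ _ H.
(* Over a nonempty word the atom runs only from [false] to [true], so the single relevant pair
   decides all its runs. *)
have E (q p : nfa_atom phi) : nfa_run q (a :: w) p = nfa_run q (a' :: w') p.
  have := H (Some false, Some true) (eqxx _); rewrite [LHS]run_completion [RHS]run_completion.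
  by move=> E; apply/idP/idP => /[dup] /nfa_atom_run [-> ->]; rewrite /fst /snd E.
have det (x y z : nfa_atom phi) b : nfa_trans x b y -> nfa_trans x b z -> y = z.
  by case/and3P => _ Hy _ /and3P [_ Hz _]; case: (y) (z) Hy Hz => [] [].
case=> [[q|] [p|]]; rewrite /fst /snd.
- by rewrite [LHS]run_completion [RHS]run_completion.
- rewrite [LHS]completion_run_to_sink // [RHS]completion_run_to_sink //.
  by congr (~~ _); apply: eq_existsb => p; apply: E.
- by rewrite [LHS]completion_run_sink [RHS]completion_run_sink.
- by rewrite [LHS]completion_run_sink [RHS]completion_run_sink.
Qed.

Lemma card_relevant (r : regex AP) : #|@relevant_pair r| <= (2 * rsize r) ^ 2.
Proof.
suff H : (forall phi, r <> RAtom phi) -> #|@relevant_pair r| <= (2 * rsize r) ^ 2.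
  by case: r H => [|phi|r1 r2|r1 r2|r1] H; try exact: H; rewrite /= card1.
move=> /card_canonical_nfa H; apply: leq_trans (max_card _) _.
by rewrite card_prod expnS expn1 leq_mul.
Qed.

End NfaRuns.

Lemma leq_card_imset_of_factor (I A B : finType) (P : {set I}) (f : I -> A) (g : I -> B) :
  {in P &, forall i j, g i = g j -> f i = f j} -> #|f @: P| <= #|g @: P|.
Proof.
move=> fg; case: (set_0Vmem P) => [->|[i0 Pi0]]; first by rewrite !imset0 cards0.
(* [F] is the factorization of [f] through [g], picking any preimage; the default [i0] is never
   reached on [g @: P]. *)
pose F b := f (odflt i0 [pick i in P | g i == b]).
apply: leq_trans (leq_imset_card F _); apply/subset_leq_card/subsetP => _ /imsetP [i Pi ->].
apply/imsetP; exists (g i); first exact: imset_f.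
rewrite /F; case: pickP => [j /andP [Pj /eqP gj]|/(_ i)]; last by rewrite Pi eqxx.
by rewrite (fg j i).
Qed.

(** * Prefix bisimilarity as a congruence for concatenation *)

Section Bisimulation.
Variables (AP : finType) (K : kripke AP) (spec : {fset regex AP}).
Implicit Types (rho u v w : seq K).

Lemma mem_PrefP u rho :
  reflect (exists v, [/\ rho = u ++ v, u != [::] & v != [::]]) (u \in Pref rho).
Proof.
apply: (iffP mapP) => [[i]|[v [-> u0 v0]]].
  rewrite mem_iota => /andP [i0 Hi] ->.
  have {}Hi : i < size rho by case: (rho) Hi => [|a s] //=; rewrite ?add1n // ltnNge i0.
  exists (drop i rho); rewrite cat_take_drop -!size_eq0 size_takel 1?ltnW //.
  by rewrite size_drop subn_eq0 -ltnNge Hi -lt0n i0.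
exists (size u); last by rewrite take_size_cat.
rewrite mem_iota size_cat -!size_eq0 -!lt0n in u0 v0 *.
by rewrite u0 add1n prednK ?addn_gt0 ?u0 // -[ltnLHS]addn0 ltn_add2l.
Qed.

Lemma mem_SuffP u rho :
  reflect (exists v, [/\ rho = v ++ u, u != [::] & v != [::]]) (u \in Suff rho).
Proof.
apply: (iffP mapP) => [[i]|[v [-> u0 v0]]].
  rewrite mem_iota => /andP [i0 Hi] ->.
  have {}Hi : i < size rho by case: (rho) Hi => [|a s] //=; rewrite ?add1n // ltnNge i0.
  exists (take i rho); rewrite cat_take_drop -!size_eq0 size_takel 1?ltnW //.
  by rewrite size_drop subn_eq0 -ltnNge Hi -lt0n i0.
exists (size v); last by rewrite drop_size_cat.
rewrite mem_iota size_cat -!size_eq0 -!lt0n in u0 v0 *.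
by rewrite v0 add1n prednK ?addn_gt0 ?v0 // -[ltnLHS]addn0 ltn_add2l.
Qed.

Local Notation summ := (summary spec).

Lemma summary_run u v (x : state_pair spec) : summ u = summ v ->
  nfa_run (tagged x).1 (tlabel u) (tagged x).2 = nfa_run (tagged x).1 (tlabel v) (tagged x).2.
Proof. by case=> _ /setP /(_ x); rewrite !inE. Qed.

(** A run over a concatenation splits at a middle state, so its end pairs are the composition of the
    two recorded relations. Nonemptiness keeps the default state out of [tfst] and [tlst]. *)
Lemma summary_cat u u' v v' : u != [::] -> u' != [::] -> v != [::] -> v' != [::] ->
  summ u = summ u' -> summ v = summ v' -> summ (u ++ v) = summ (u' ++ v').
Proof.
move=> u0 u'0 v0 v'0 Eu Ev; congr (_, _, _).
- by case: Eu; case: u u' u0 u'0 => [|a u] [|a' u'].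
- apply/setP => x; rewrite !inE /tlabel !map_cat !nfa_run_cat.
  case: x => r [q p] /=; apply/eq_existsb => m.
  have := summary_run (Tagged (fun r : spec => _) (q, m)) Eu.
  have := summary_run (Tagged (fun r : spec => _) (m, p)) Ev.
  by rewrite /= => -> ->.
- by case: Ev => _ _; rewrite /tlst !last_cat; case: v v' v0 v'0 => [|a v] [|a' v'].
Qed.

Lemma prefix_bisim_summary h u v : prefix_bisim spec h u v -> summ u = summ v.
Proof. by case: h => [|h] []. Qed.

Lemma prefix_bisimW h u v : prefix_bisim spec h.+1 u v -> prefix_bisim spec h u v.
Proof.
elim: h u v => [|h IH] u v [E [H1 H2]]; split=> //; split=> nu /[dup] Hnu.
- by case/H1 => nu' Hnu' /IH H; exists nu'.
- by case/H2 => nu' Hnu' /IH H; exists nu'.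
Qed.

Lemma prefix_bisim_refl h u : prefix_bisim spec h u u.
Proof. by elim: h u => [|h IH] u; split=> //; split=> nu ?; exists nu. Qed.

Lemma prefix_bisim_sym h u v : prefix_bisim spec h u v -> prefix_bisim spec h v u.
Proof.
elim: h u v => [|h IH] u v [E H]; split=> //.
by case: H => H1 H2; split=> nu; [case/H2|case/H1] => nu' ? /IH; exists nu'.
Qed.

Lemma Pref_rcons u x nu : u != [::] ->
  (nu \in Pref (rcons u x)) = (nu == u) || (nu \in Pref u).
Proof.
move=> u0; apply/mem_PrefP/orP.
  case=> v [E nu0]; case/lastP: v E => // v y.
  rewrite -rcons_cat => /rcons_inj [-> _] _; case: v => [|z v].
    by left; rewrite cats0.
  by right; apply/mem_PrefP; exists (z :: v).
case=> [/eqP ->|/mem_PrefP [v [-> nu0 v0]]].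
  by exists [:: x]; rewrite cats1.
by exists (rcons v x); rewrite rcons_cat; split=> //; case: (v).
Qed.

Lemma Pref_cons u x nu : u != [::] ->
  nu \in Pref (x :: u) <-> nu = [:: x] \/ exists2 nu', nu = x :: nu' & nu' \in Pref u.
Proof.
move=> u0; split.
  case/mem_PrefP => v []; case: nu => [//|y [|z nu]] [-> E] _ v0; first by left.
  by right; exists (z :: nu) => //; apply/mem_PrefP; exists v.
case=> [->|[nu' -> /mem_PrefP [v [-> nu0 v0]]]]; apply/mem_PrefP; first by exists u.
by exists v.
Qed.

(** The only new proper prefix is [u] itself, matched by [v] one level lower. *)
Lemma prefix_bisim_rcons h u v x : u != [::] -> v != [::] ->
  prefix_bisim spec h u v -> prefix_bisim spec h (rcons u x) (rcons v x).
Proof.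
elim: h u v => [|h IH] u v u0 v0 H; (split; first
  by rewrite -!cats1; apply: summary_cat => //; apply: prefix_bisim_summary H) => //.
have Huv := prefix_bisimW H; case: H => _ [H1 H2].
split=> nu; rewrite Pref_rcons // => /orP [/eqP ->|].
- by exists v => //; rewrite Pref_rcons // eqxx.
- by case/H1 => nu' Hnu' ?; exists nu' => //; rewrite Pref_rcons // Hnu' orbT.
- by exists u => //; rewrite Pref_rcons // eqxx.
- by case/H2 => nu' Hnu' ?; exists nu' => //; rewrite Pref_rcons // Hnu' orbT.
Qed.

Lemma prefix_bisim_catr h u v w : u != [::] -> v != [::] ->
  prefix_bisim spec h u v -> prefix_bisim spec h (u ++ w) (v ++ w).
Proof.
move=> u0 v0 H; elim/last_ind: w => [|w x IH]; first by rewrite !cats0.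
by rewrite -!rcons_cat; apply: prefix_bisim_rcons IH;
  rewrite -size_eq0 size_cat addn_eq0 size_eq0 negb_and ?u0 ?v0.
Qed.

Lemma prefix_bisim_cons h u v x : u != [::] -> v != [::] ->
  prefix_bisim spec h u v -> prefix_bisim spec h (x :: u) (x :: v).
Proof.
elim: h u v => [|h IH] u v u0 v0 H; (split; first
  by apply: (@summary_cat [:: x] [:: x]) => //; apply: prefix_bisim_summary H) => //.
case: H => _ [H1 H2].
have P0 nu (s : seq K) : nu \in Pref s -> nu != [::] by case/mem_PrefP => ? [].
split=> nu /(Pref_cons _ _) [//|->|[nu' -> Hnu']].
- by exists [:: x]; [apply/Pref_cons => //; left|apply: prefix_bisim_refl].
- have [nv Hnv Hb] := H1 _ Hnu'; exists (x :: nv).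
    by apply/Pref_cons => //; right; exists nv.
  by apply: IH Hb; apply: P0; eassumption.
- by exists [:: x]; [apply/Pref_cons => //; left|apply: prefix_bisim_refl].
- have [nv Hnv Hb] := H2 _ Hnu'; exists (x :: nv).
    by apply/Pref_cons => //; right; exists nv.
  by apply: IH Hb; apply: P0; eassumption.
Qed.

Lemma prefix_bisim_catl h u v w : u != [::] -> v != [::] ->
  prefix_bisim spec h u v -> prefix_bisim spec h (w ++ u) (w ++ v).
Proof.
move=> u0 v0 H; elim: w => [//|x w IH] /=.
by apply: prefix_bisim_cons IH;
  rewrite -size_eq0 size_cat addn_eq0 !size_eq0 negb_and ?u0 ?v0 orbT.
Qed.

(** * Bisimilar traces satisfy the same formulas *)

Lemma is_trace_catP u v : u != [::] -> v != [::] ->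
  is_trace (u ++ v) = [&& is_trace u, is_trace v & kedge (tlst u) (tfst v)].
Proof.
case: u v => [|a u] [|b v] // _ _; rewrite /is_trace /tlst /tfst /= cat_path /=.
by case: (path _ _ u); rewrite //= andbC.
Qed.

Lemma summary_lang r u v : r \in spec -> summ u = summ v ->
  lang r (tlabel u) -> lang r (tlabel v).
Proof.
move=> Hr E /canonical_nfaP [q [p [Hq Hp H]]].
apply/canonical_nfaP; exists q, p; split=> //.
pose x : state_pair spec :=
  Tagged (fun r : spec => (canonical_nfa (val r) * canonical_nfa (val r))%type)
    (i := [` Hr]%fset) (q, p).
by rewrite -(summary_run x E).
Qed.

(** [ModA] and [ModAbar] see only the end states, which the summary records. [ModB] consumes one
    level of bisimilarity, while [ModBbar] and [ModEbar] preserve the level by congruence on the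
    right and on the left. *)
Lemma prefix_bisim_sat psi h u v :
  (forall r, r \in atoms psi -> r \in spec) -> depthB psi <= h ->
  is_trace u -> is_trace v -> prefix_bisim spec h u v -> sat psi u -> sat psi v.
Proof.
elim: psi h u v => [r|f IH|f IHf g IHg|X f IH] h u v /= Ha Hd Hu Hv Huv.
- by apply: summary_lang (prefix_bisim_summary Huv); apply: Ha; rewrite inE.
- by move=> Hf /(IH h v u Ha Hd Hv Hu (prefix_bisim_sym Huv)).
- move: Hd; rewrite geq_max => /andP [Hdf Hdg] [Hf Hg].
  by split; [apply: IHf Hf|apply: IHg Hg]; try eassumption;
     move=> r Hr; apply: Ha; rewrite inE Hr ?orbT.
have [u0 v0] : u != [::] /\ v != [::] by case/andP: Hu; case/andP: Hv.
have Es := prefix_bisim_summary Huv.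
have [Ef _ El] := Es.
case=> w [Hw HX Hs]; case: X Hd HX => /= Hd HX.
- by exists w; rewrite -El.
- by exists w; rewrite -Ef.
- case: h Hd Huv => // h Hd [_ [H1 _]].
  have [w' Hw' Hww'] := H1 _ HX; exists w'.
  have Tw' : is_trace w'.
    by case/mem_PrefP: Hw' Hv => s [-> s0 s1]; rewrite is_trace_catP // => /and3P [].
  by split=> //; apply: IH Hs; eassumption.
- case/mem_PrefP: HX Hw Hs => s [-> _ s0]; rewrite is_trace_catP // => /and3P [_ Ts Es'] Hs.
  have Tvs : is_trace (v ++ s) by rewrite is_trace_catP // Hv Ts -El.
  exists (v ++ s); split=> //; first by apply/mem_PrefP; exists s.
  apply: (IH h (u ++ s)) Hs => //; first by rewrite is_trace_catP // Hu Ts.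
  exact: prefix_bisim_catr.
- case/mem_SuffP: HX Hw Hs => s [-> _ s0]; rewrite is_trace_catP // => /and3P [Ts _ Es'] Hs.
  have Tsv : is_trace (s ++ v) by rewrite is_trace_catP // Hv Ts -Ef.
  exists (s ++ v); split=> //; first by apply/mem_SuffP; exists s.
  apply: (IH h (s ++ u)) Hs => //; first by rewrite is_trace_catP // Hu Ts.
  exact: prefix_bisim_catl.
Qed.

(** * Bisimilarity classes and the number of summaries *)

Fixpoint bisim_class h : finType :=
  if h is h'.+1 then ((K * {set state_pair spec} * K) * {set bisim_class h'})%type
  else (K * {set state_pair spec} * K)%type.

(** A complete invariant with values in a finite type: bisimilarity becomes a decidable equality,
    and classes can be counted. *)
Fixpoint class_of h rho : bisim_class h :=
  match h with
  | 0 => summ rho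
  | h'.+1 => (summ rho, [set t | t \in map (class_of h') (Pref rho)])
  end.

Lemma class_ofP h u v : class_of h u = class_of h v <-> prefix_bisim spec h u v.
Proof.
elim: h u v => [|h IH] u v /=; first by split=> [|[]].
split=> [E0|[E [H1 H2]]].
  have [/= E /setP H] := (congr1 fst E0, congr1 snd E0).
  split=> //; split=> nu /(map_f (class_of h)) Hnu.
    by have := H (class_of h nu); rewrite !inE Hnu => /esym /mapP [nu' ? /IH]; exists nu'.
  have := H (class_of h nu); rewrite !inE Hnu => /mapP [nu' ? E']; exists nu' => //.
  by apply/IH.
congr (_, _) => //; apply/setP => t; rewrite !inE.
apply/mapP/mapP => [[nu Hnu ->]|[nu Hnu ->]].
  by have [nu' ? /IH E'] := H1 _ Hnu; exists nu'.
by have [nu' ? /IH E'] := H2 _ Hnu; exists nu'.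
Qed.

Definition relevant_pairs : {set state_pair spec} :=
  [set x : state_pair spec | relevant_pair (tagged x)].

Definition num_summaries := #|kstate K| * 2 ^ ((2 * spec_size spec) ^ 2).

Lemma card_relevant_pairs : #|relevant_pairs| <= (2 * spec_size spec) ^ 2.
Proof.
rewrite -sum1dep_card.
have /= <- := @sig_big_dep _ 0 addn _ _ predT
  (fun (r : spec) (x : canonical_nfa (val r) * canonical_nfa (val r)) => relevant_pair x)
  (fun _ _ => 1).
have -> : spec_size spec = \sum_(r : spec) rsize (val r) by rewrite /spec_size big_seq_fsetE.
apply: leq_trans (_ : \sum_(r : spec) (2 * rsize (val r)) ^ 2 <= _).
  by apply: leq_sum => r _; rewrite sum1_card card_relevant.
rewrite big_distrr /=.
(* A sum of squares is at most the square of the sum: the cross terms are dropped. *)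
elim/big_rec2: _ => // r m n _ H; rewrite sqrnD.
by apply: leq_trans (leq_addr _ _); rewrite leq_add2l.
Qed.

(** Prefixes of one trace share their first state, so only the last state is recorded; hence the
    single factor |S| in [num_summaries]. *)
Definition relevant_summary rho : {set state_pair spec} * K :=
  ([set x in relevant_pairs | nfa_run (tagged x).1 (tlabel rho) (tagged x).2], tlst rho).

Definition relevant_summaries := setX (powerset relevant_pairs) [set: K].

Lemma card_relevant_summaries : #|relevant_summaries| <= num_summaries.
Proof.
rewrite cardsX card_powerset cardsT mulnC leq_mul2l.
by rewrite leq_pexp2l ?card_relevant_pairs ?orbT.
Qed.

Lemma mem_relevant_summaries rho : relevant_summary rho \in relevant_summaries.
Proof. by rewrite !inE andbT; apply/subsetP => x; rewrite inE => /andP []. Qed.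

Lemma relevant_summary_inj u v : u != [::] -> v != [::] -> tfst u = tfst v ->
  relevant_summary u = relevant_summary v -> summ u = summ v.
Proof.
move=> u0 v0 Ef [/setP E El]; congr (_, _, _) => //; apply/setP => -[r x]; rewrite !inE /=.
apply: relevant_run => [||y Hy]; [by case: (u) u0|by case: (v) v0|].
have := E (Tagged (fun r : spec => (canonical_nfa (val r) * canonical_nfa (val r))%type) y).
by rewrite !inE /= Hy.
Qed.

(** * Counting the classes of the prefixes of a trace *)

Section PrefixClasses.
Variable rho : seq K.
Local Notation n := (size rho).

Definition prefix_class h (k : 'I_n) := class_of h (take k.+1 rho).
Definition num_classes h := #|prefix_class h @: [set: 'I_n]|.

Lemma take_neq0 (k : 'I_n) : take k.+1 rho != [::].
Proof. by case: (rho) k => [[]|]. Qed.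

Lemma prefix_summary_inj (k l : 'I_n) :
  relevant_summary (take k.+1 rho) = relevant_summary (take l.+1 rho) ->
  summ (take k.+1 rho) = summ (take l.+1 rho).
Proof. by apply: relevant_summary_inj; rewrite ?take_neq0 //; case: (rho) k l => [[]|]. Qed.

Lemma num_classes0 : num_classes 0 <= num_summaries.
Proof.
apply: leq_trans card_relevant_summaries.
pose g (k : 'I_n) := relevant_summary (take k.+1 rho).
apply: leq_trans (leq_card_imset_of_factor (g := g) _) _.
  by move=> k l _ _ /prefix_summary_inj.
by apply/subset_leq_card/subsetP => _ /imsetP [k _ ->]; apply: mem_relevant_summaries.
Qed.

(** The second component of [prefix_class h.+1 k]. *)
Definition past h (k : 'I_n) := [set t | t \in map (class_of h) (Pref (take k.+1 rho))].

Lemma pastP h (k : 'I_n) t :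
  reflect (exists2 l : 'I_n, l < k & t = prefix_class h l) (t \in past h k).
Proof.
rewrite inE; apply: (iffP mapP) => [[nu /mapP [i]]|[l lk ->]].
  rewrite mem_iota size_takel // => /andP [i0 Hi] -> ->.
  rewrite /= add1n ltnS in Hi.
  have Hl : i.-1 < n by apply: leq_ltn_trans (leq_pred i) (leq_ltn_trans Hi (ltn_ord k)).
  exists (Ordinal Hl) => /=; first by rewrite prednK.
  by rewrite /prefix_class /= prednK // take_takel // leqW.
exists (take l.+1 rho) => //; apply/mapP; exists l.+1.
  by rewrite mem_iota size_takel //= add1n ltnS.
by rewrite take_takel // leqW.
Qed.

Lemma past_sub h (k l : 'I_n) : k <= l -> past h k \subset past h l.
Proof.
move=> kl; apply/subsetP => t /pastP [m mk ->]; apply/pastP; exists m => //.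
exact: leq_trans mk kl.
Qed.

Lemma past_eq h (k l : 'I_n) : #|past h k| = #|past h l| -> past h k = past h l.
Proof.
wlog kl : k l / k <= l => [H E|E].
  by case/orP: (leq_total k l) => /H ->.
by apply/eqP; rewrite eqEcard past_sub //= E.
Qed.

Lemma card_past h (k : 'I_n) : #|past h k| <= num_classes h.
Proof. by apply/subset_leq_card/subsetP => t /pastP [l _ ->]; rewrite imset_f. Qed.

(* The pasts form an increasing chain, so a past is determined by its
   cardinality, which is positive except at the first position. *)
Lemma num_classesS h : num_classes h.+1 <= (num_summaries * num_classes h).+1.
Proof.
(* The first position, whose past is empty, is counted apart and gives the successor in the
   bound. *)
pose P := [set k : 'I_n | 0 < k].
rewrite {1}/num_classes -(setUCr P) setUC imsetU; apply: leq_trans (leq_card_setU _ _) _.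
rewrite -[leqRHS]add1n; apply: leq_add.
  apply: leq_trans (leq_imset_card _ _) _; apply/card_le1_eqP => k l.
  by rewrite !inE -!eqn0Ngt => /eqP Ek /eqP El; apply: val_inj; rewrite /= Ek El.
pose g (k : 'I_n) := (relevant_summary (take k.+1 rho),
  inord #|past h k| : 'I_(num_classes h).+1).
apply: leq_trans (leq_card_imset_of_factor (g := g) _) _.
  move=> k l _ _ [] E1 E2 /(congr1 val) /=; rewrite !inordK ?ltnS ?card_past // => /past_eq E3.
  have E : relevant_summary (take k.+1 rho) = relevant_summary (take l.+1 rho).
    by rewrite /relevant_summary E1 E2.
  by congr (_, _); [apply: prefix_summary_inj|apply: E3].
(* Excluding [ord0] leaves [num_classes h] cardinalities: the past of a later position contains the
   class of the first one. *)
apply: leq_trans (_ : #|setX relevant_summaries [set~ ord0 : 'I_(num_classes h).+1]| <= _).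
  apply/subset_leq_card/subsetP => _ /imsetP [k Hk ->].
  rewrite in_setX mem_relevant_summaries !inE -val_eqE /= inordK ?ltnS ?card_past //.
  rewrite -lt0n card_gt0; apply/set0Pn.
  have k0 : 0 < n by apply: leq_ltn_trans (ltn_ord k).
  exists (prefix_class h (Ordinal k0)); apply/pastP; exists (Ordinal k0) => //.
  by rewrite inE in Hk.
by rewrite cardsX cardsC1 card_ord leq_mul // card_relevant_summaries.
Qed.

Lemma num_classes_bound h : 1 < num_summaries ->
  num_classes h < num_summaries ^ h.+1 + num_summaries ^ h.
Proof.
set N := num_summaries => N1; elim: h => [|h IH].
  by rewrite expn0 expn1 addn1 ltnS num_classes0.
apply: leq_ltn_trans (num_classesS h) _; rewrite -/N.
rewrite (expnS _ h.+1) [N ^ h.+1 in X in _ + X]expnS -mulnDr.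
(* Multiplying the strict bound on T_h by N leaves room for N more than N * T_h, which covers the
   recurrence's 1 strictly since N >= 2. *)
by apply: leq_trans (leq_mul (leqnn N) IH); rewrite mulnS -add2n leq_add2r.
Qed.

End PrefixClasses.

(** * Shortening a trace *)

(* Cutting between two bisimilar prefixes that both differ from the whole trace
   keeps its first and last positions. *)
Lemma exists_induced_distinct_prefixes rho h : is_trace rho ->
  exists rho', [/\ induced rho rho', prefix_bisim spec h rho rho'
    & forall a b, a < b < (size rho').-1 ->
        class_of h (take a.+1 rho') <> class_of h (take b.+1 rho')].
Proof.
move=> Trho; have rho0 : rho != [::] by case/andP: Trho.
pose word js := [seq nth (kinit K) rho i | i <- 0 :: js].
pose good js := [/\ path ltn 0 js, last 0 js = (size rho).-1, is_trace (word js)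
  & prefix_bisim spec h rho (word js)].
have [js0 good0] : exists js, good js.
  exists (iota 1 (size rho).-1).
  have E : 0 :: iota 1 (size rho).-1 = iota 0 (size rho) by case: (rho) rho0.
  have Ew : word (iota 1 (size rho).-1) = rho by rewrite /word E map_nth_iota0 ?take_size.
  split; rewrite ?Ew //; last exact: prefix_bisim_refl.
    by rewrite -[path _ _ _]/(sorted ltn (0 :: iota 1 (size rho).-1)) E iota_ltn_sorted.
  rewrite -[LHS]/(last 0 (0 :: iota 1 (size rho).-1)) E -nth_last.
  by rewrite size_iota nth_iota // ltn_predL; case: (rho) rho0.
have [m] := ubnP (size js0); elim: m js0 good0 => // m IH js [Hp Hl Ht Hb] Hm.
(* [word js] has length [(size js).+1], so indices below [size js] give prefixes other than the
   whole word. *)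
have [/existsP [a /existsP [b /andP [ab /eqP E]]]|none] := boolP
  [exists a : 'I_(size js), exists b : 'I_(size js), (a < b) &&
     (class_of h (take a.+1 (word js)) == class_of h (take b.+1 (word js)))]; last first.
  exists (word js); split=> //; first by split=> //; exists js.
  move=> a b /andP [ab]; rewrite /= size_map => Hbs E; case/negP: none.
  have Has := ltn_trans ab Hbs.
  by apply/existsP; exists (Ordinal Has); apply/existsP; exists (Ordinal Hbs); rewrite ab E eqxx.
have sb := ltn_ord b; have sa := ltn_ord a.
(* Since [word] prepends position 0, this deletes the letters [a.+1] to [b] of [word js]. *)
pose js' := take a js ++ drop b js.
have Ew : word js = take b.+1 (word js) ++ drop b.+1 (word js) by rewrite cat_take_drop.
have Ew' : word js' = take a.+1 (word js) ++ drop b.+1 (word js).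
  by rewrite /word /js' /= map_cat map_take map_drop.
have [ta tb d0] : [/\ take a.+1 (word js) != [::], take b.+1 (word js) != [::]
    & drop b.+1 (word js) != [::]].
  by split=> //; rewrite -size_eq0 size_drop /= size_map subn_eq0 -ltnNge ltnS.
have Hab : prefix_bisim spec h (take b.+1 (word js)) (take a.+1 (word js)).
  by apply/class_ofP.
apply: (IH js').
- split.
  + have : subseq js' js.
      rewrite /js' -[X in subseq _ X](cat_take_drop b js); apply: cat_subseq => //.
      by rewrite -(@take_takel _ a b js (ltnW ab)) take_subseq.
    by move=> sub; apply: (subseq_path ltn_trans sub).
  + rewrite -Hl -[in RHS](cat_take_drop b js) /js' !last_cat.
    by case: (drop b js) (size_drop b js) => //= /esym /eqP; rewrite subn_eq0 leqNgt sb.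
  + rewrite Ew' is_trace_catP //.
    have := Ht; rewrite {1}Ew is_trace_catP // => /and3P [_ -> Hed].
    (* Both prefixes end in the same state, so the edge leaving the longer one also leaves the
       shorter one. *)
    have /= El : tlst _ = tlst _ := congr1 snd (prefix_bisim_summary Hab).
    rewrite -[X in kedge X _]El Hed /= andbT.
    have := Ht; rewrite -{1}(cat_take_drop a.+1 (word js)) is_trace_catP //.
      by case/and3P.
    by rewrite -size_eq0 size_drop /= size_map subn_eq0 -ltnNge ltnS.
  + apply/class_ofP; have /class_ofP -> := Hb; apply/class_ofP.
    by rewrite Ew' {1}Ew; apply: prefix_bisim_catr.
- rewrite -ltnS; apply: leq_trans Hm; rewrite ltnS /js' size_cat.
  rewrite size_takel ?size_drop; last exact: ltnW.
  by rewrite addnBA ?(ltnW sb) // ltn_subLR ?ltn_add2r // ltnW // ltn_addl.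
Qed.

(** All prefixes but the whole trace have distinct classes; the successor accounts for the whole
    trace. *)
Lemma size_distinct_prefixes rho h :
  (forall a b, a < b < (size rho).-1 ->
     class_of h (take a.+1 rho) <> class_of h (take b.+1 rho)) ->
  size rho <= (num_classes rho h).+1.
Proof.
move=> D; pose P := [set k : 'I_(size rho) | k < (size rho).-1].
have inj : {in P &, injective (prefix_class h (rho := rho))}.
  move=> k l; rewrite !inE => Hk Hl E; apply: val_inj => /=.
  by case: (ltngtP k l) => // kl; [case: (D k l)|case: (D l k)]; rewrite ?kl.
suff : (size rho).-1 <= #|P|.
  rewrite -(card_in_imset inj) => H; apply: leq_trans (leqSpred _) _; rewrite ltnS.
  by apply: leq_trans H _; apply/subset_leq_card/imsetS/subsetT.
pose f (i : 'I_(size rho).-1) : 'I_(size rho) := widen_ord (leq_pred _) i.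
have finj : injective f by move=> i j /(congr1 val) /= /val_inj.
rewrite -[leqLHS]card_ord -cardsT -(card_imset _ finj).
by apply/subset_leq_card/subsetP => _ /imsetP [i _ ->]; rewrite inE /=.
Qed.

End Bisimulation.

Theorem theorem1 (AP : finType) (K : kripke AP) (spec : {fset regex AP})
    (hspec : spec != fset0 \/ 1 < #|kstate K|)
    (rho : seq (kstate K)) (hrho : is_trace rho) (h : nat) :
  exists rho' : seq (kstate K),
    [/\ induced rho rho',
        size rho' <= (#|kstate K| * 2 ^ ((2 * spec_size spec) ^ 2)) ^ (h + 2),
        prefix_bisim spec h rho rho' &
        forall psi : form AP,
          (forall r : regex AP, r \in atoms psi -> r \in spec) ->
          depthB psi <= h ->
          (sat psi rho <-> sat psi rho')].
Proof.
have [rho' [Hi Hb D]] := exists_induced_distinct_prefixes spec h hrho.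
have hrho' : is_trace rho' by case: Hi.
exists rho'; split=> //; last first.
  move=> psi Ha Hd; split; first exact: (prefix_bisim_sat Ha Hd).
  by apply: (prefix_bisim_sat Ha Hd) => //; apply: prefix_bisim_sym.
rewrite -/(num_summaries K spec).
(* A member of [spec] makes the exponent of 2 positive; otherwise there are two states. *)
have N1 : 1 < num_summaries K spec.
  have K0 : 0 < #|kstate K| by apply/card_gt0P; exists (kinit K).
  case: hspec => [/fset0Pn [r Hr]|K1]; rewrite /num_summaries.
    apply: leq_trans (leq_pmull _ K0).
    rewrite -[X in X <= _]expn1 leq_exp2l // expn_gt0 muln_gt0 /=.
    rewrite /spec_size (big_fsetD1 r) //= addn_gt0.
    by case: (r).
  by apply: leq_trans K1 (leq_pmulr _ _); rewrite expn_gt0.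
apply: leq_trans (size_distinct_prefixes D) _.
apply: leq_trans (num_classes_bound _ _ N1) _.
(* N^(h+1) + N^h <= 2 * N^(h+1) <= N^(h+2). *)
rewrite addn2 [leqRHS]expnS; apply: leq_trans (leq_mul N1 (leqnn _)).
by rewrite mul2n -addnn leq_add2l leq_pexp2l // ltnW.
Qed.
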